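(* For every integer $k\ge 1$, the following identity of formal power series in $q$ holds: $$\sum_{n=0}^{\infty}RD_3^{3,3}\left(3^kn+\frac{3^k+1}{2}\right)q^n=\sum_{i=1}^{\frac{3^{k-1}+1}{2}}x_{k,i}\,q^{i-1}\frac{E_3^{3(4i-2)}}{E_1^{3(4i-2)}},$$ where the coefficient vectors $x_k=(x_{k,1},x_{k,2},\ldots)$ are given by $x_1=(9,0,0,0,\ldots)$ and, for $k\ge1$, $x_{k+1}=x_k\cdot A$ (row vector times infinite matrix), where $A=(a_{i,j})_{i,j\ge1}$ is defined by $a_{i,j}=m_{4i-2,\,i+j-1}$ and $M=(m_{i,j})_{i,j\ge1}$ is the integer matrix defined in the context.
   Context: For $r\ge1$, $E_r=\prod_{n=1}^{\infty}(1-q^{nr})$, $|q|<1$ (or as a formal power series in $q$). For positive integers $\ell,t,k$, $RD_k^{\ell,t}(n)$ denotes the number of partitions of $n$ in which each part carries one of $k$ colors, no part is divisible by $\ell$, and each colored part appears fewer than $t$ times; its generating function is $$\sum_{n=0}^{\infty}RD_k^{\ell,t}(n)q^n=\left(\frac{E_\ell E_t}{E_1E_{\ell t}}\right)^k.$$ In particular $\sum_{n\ge0}RD_3^{3,3}(n)q^n=\left(\frac{E_3^2}{E_1E_9}\right)^3$. The matrix $M$: let $H_3$ be the operator on formal Laurent series in $q$ given by $H_3\left(\sum_n a(n)q^n\right)=\sum_n a(3n)q^{3n}$, and put $$\zeta=\frac{E_1^3}{qE_9^3},\qquad T=\frac{E_3^{12}}{q^3E_9^{12}}.$$ The numbers $m_{i,j}$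 are defined by the expansions $H_3\left(\zeta^{-i}\right)=\sum_{j=1}^{i}m_{i,j}T^{-j}$ for $i\ge1$, with $m_{i,j}=0$ for $j>i$. Explicitly, the first three rows of $M$ are $(9,0,0,0,\ldots)$, $(6,243,0,0,\ldots)$, $(1,243,6561,0,\ldots)$, and for $i\ge4$ one has $m_{i,1}=0$ and $m_{i,j}=27m_{i-1,j-1}+9m_{i-2,j-1}+m_{i-3,j-1}$ for $j\ge2$. *)

(* Defs.v *)
From HB Require Import structures.
From mathcomp Require Import all_boot all_order all_algebra.
From mathcomp Require Import boolp classical_sets fsbigop.

Set Implicit Arguments.
Unset Strict Implicit.
Unset Printing Implicit Defensive.

Import GRing.Theory.
Local Open Scope ring_scope.

(* Formal power series over R, as coefficient sequences with the Cauchy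
   product. A series is a unit exactly when its constant coefficient is. *)

Record fps (R : Type) := FPS { fcoef :> nat -> R }.

Lemma fpsP (R : Type) (f g : fps R) : (forall n, f n = g n) -> f = g.
Proof.
by case: f g => [f] [g] /= fg; congr FPS; apply: functional_extensionality_dep.
Qed.

HB.instance Definition _ (R : Type) := gen_eqMixin (fps R).
HB.instance Definition _ (R : Type) := gen_choiceMixin (fps R).

Section FpsRing.
Variable R : comUnitRingType.
Implicit Types f g h : fps R.

Definition fps_zero : fps R := FPS (fun _ => 0).
Definition fps_one : fps R := FPS (fun n => (n == 0%N)%:R).
Definition fps_opp f : fps R := FPS (fun n => - f n).
Definition fps_add f g : fps R := FPS (fun n => f n + g n).
Definition fps_mul f g : fps R :=
  FPS (fun n => \sum_(i < n.+1) f i * g (n - i)%N).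

Fact fps_addA : associative fps_add.
Proof. by move=> f g h; apply: fpsP => n /=; rewrite addrA. Qed.
Fact fps_addC : commutative fps_add.
Proof. by move=> f g; apply: fpsP => n /=; rewrite addrC. Qed.
Fact fps_add0 : left_id fps_zero fps_add.
Proof. by move=> f; apply: fpsP => n /=; rewrite add0r. Qed.
Fact fps_addN : left_inverse fps_zero fps_opp fps_add.
Proof. by move=> f; apply: fpsP => n /=; rewrite addNr. Qed.

HB.instance Definition _ :=
  GRing.isZmodule.Build (fps R) fps_addA fps_addC fps_add0 fps_addN.

Definition fps_trunc N f : {poly R} := \poly_(i < N) f i.

Fact coef_fps_trunc N f n : (n < N)%N -> (fps_trunc N f)`_n = f n.
Proof. by rewrite coef_poly => ->. Qed.

Fact coef_fps_mul N f g n : (n < N)%N ->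
  fps_mul f g n = (fps_trunc N f * fps_trunc N g)`_n.
Proof.
move=> ltnN; rewrite coefM; apply: eq_bigr => i _.
rewrite !coef_fps_trunc ?(leq_ltn_trans _ ltnN) ?leq_subr //.
by rewrite -ltnS ltn_ord.
Qed.

Fact fps_mulA : associative fps_mul.
Proof.
move=> f g h; apply: fpsP => n.
transitivity (fps_trunc n.+1 f * (fps_trunc n.+1 g * fps_trunc n.+1 h))`_n.
  rewrite coefM; apply: eq_bigr => i _; rewrite coef_fps_trunc //.
  by rewrite (@coef_fps_mul n.+1) // ltnS leq_subr.
rewrite mulrA coefM; apply: eq_bigr => i _.
by rewrite (@coef_fps_trunc _ h) ?ltnS ?leq_subr // (@coef_fps_mul n.+1).
Qed.

Fact fps_mulC : commutative fps_mul.
Proof. by move=> f g; apply: fpsP => n; rewrite !(@coef_fps_mul n.+1) // mulrC. Qed.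

Fact fps_mul1 : left_id fps_one fps_mul.
Proof.
move=> f; apply: fpsP => n /=; rewrite big_ord_recl /= mul1r subn0.
by rewrite big1 ?addr0 // => i _; rewrite mul0r.
Qed.

Fact fps_mulDl : left_distributive fps_mul fps_add.
Proof.
move=> f g h; apply: fpsP => n /=; rewrite -big_split.
by apply: eq_bigr => i _; rewrite mulrDl.
Qed.

Fact fps_one_neq0 : fps_one != fps_zero.
Proof.
apply/eqP => /(congr1 (fun f : fps R => f 0%N)) /= /eqP.
by rewrite oner_eq0.
Qed.

HB.instance Definition _ := GRing.Zmodule_isComNzRing.Build (fps R)
  fps_mulA fps_mulC fps_mul1 fps_mulDl fps_one_neq0.

Fact fps_coefM f g n : (f * g) n = \sum_(i < n.+1) f i * g (n - i)%N.
Proof. by []. Qed.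

Fact fps_coefD f g n : (f + g) n = f n + g n.
Proof. by []. Qed.

Fact fps_coefB f g n : (f - g) n = f n - g n.
Proof. by []. Qed.

Fact fps_coef1 n : (1 : fps R) n = (n == 0%N)%:R.
Proof. by []. Qed.

Fact fps_coef_sum I (r : seq I) (P : pred I) (F : I -> fps R) n :
  (\sum_(i <- r | P i) F i) n = \sum_(i <- r | P i) F i n.
Proof. by elim/big_rec2: _ => [|i x y _ <-]. Qed.

Fact fps_coefX_small f m n : f 0%N = 0 -> (n < m)%N -> (f ^+ m) n = 0.
Proof.
move=> f0; elim: m n => [|m IHm] n //; rewrite ltnS => le_nm.
rewrite exprS fps_coefM big_ord_recl f0 mul0r add0r big1 // => i _ /=.
rewrite IHm ?mulr0 // /bump /= add1n subnSK // (leq_trans _ le_nm) //.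
exact: leq_subr.
Qed.

Definition fps_const (c : R) : fps R :=
  FPS (fun n => if n == 0%N then c else 0).

Fact fps_coef_constM c f n : (fps_const c * f) n = c * f n.
Proof.
rewrite fps_coefM big_ord_recl subn0 big1 ?addr0 // => i _.
by rewrite mul0r.
Qed.

Definition fps_unit : pred (fps R) := fun f => f 0%N \is a GRing.unit.

(* With c = (f 0)^-1, f^-1 = c * \sum_m (1 - c f)^m, where only the terms with
   m <= n contribute to the coefficient of index n. *)
Definition fps_inv f : fps R :=
  if fps_unit f then
    FPS (fun n => (fps_const (f 0%N)^-1 *
                   \sum_(m < n.+1) (1 - fps_const (f 0%N)^-1 * f) ^+ m) n)
  else f.

Fact fps_mulV : {in fps_unit, left_inverse 1 fps_inv *%R}.
Proof.
move=> f Uf; have {}Uf : fps_unit f by []; rewrite /fps_inv Uf.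
set c := fps_const _; set g := 1 - c * f.
have g0 : g 0%N = 0.
  by rewrite /g fps_coefB fps_coef_constM mulVr // subrr.
apply: fpsP => n; rewrite [LHS]fps_coefM.
transitivity (((c * \sum_(m < n.+1) g ^+ m) * f) n).
  rewrite fps_coefM; apply: eq_bigr => i _; congr (_ * _).
  transitivity ((c * \sum_(m < i.+1) g ^+ m) i); first by [].
  rewrite !fps_coef_constM; congr (_ * _); rewrite !fps_coef_sum.
  rewrite (big_ord_widen n.+1 (fun m => (g ^+ m) i)) ?ltn_ord //.
  rewrite [RHS](bigID (fun m : 'I_n.+1 => (m < i.+1)%N)) /=.
  rewrite [X in _ + X]big1 ?addr0 // => m; rewrite -leqNgt => lt_im.
  exact: fps_coefX_small.
have -> : c * (\sum_(m < n.+1) g ^+ m) * f = 1 - g ^+ n.+1.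
  rewrite mulrAC -[1 in RHS](expr1n _ n.+1) subrXX [1 - g]subKr; congr (_ * _).
  by apply: eq_bigr => i _; rewrite expr1n mul1r.
by rewrite fps_coefB (fps_coefX_small g0) ?subr0.
Qed.

Fact fps_unitPl f g : g * f = 1 -> fps_unit f.
Proof.
move=> /(congr1 (fun h : fps R => h 0%N)).
rewrite fps_coefM big_ord1 fps_coef1 eqxx /= => gf1.
by apply/unitrPr; exists (g 0%N); rewrite mulrC.
Qed.

Fact fps_inv_out : {in [predC fps_unit], fps_inv =1 id}.
Proof. by move=> f; rewrite inE /= /fps_inv => nUf; rewrite ifN. Qed.

HB.instance Definition _ := GRing.ComNzRing_hasMulInverse.Build (fps R)
  fps_mulV fps_unitPl fps_inv_out.

End FpsRing.

Definition q : fps int := FPS (fun n => (n == 1%N)%:R).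

(* E r is the q-adic limit of its partial products: for r > 0 the factors with
   m > n do not affect the coefficient of index n. *)
Definition E (r : nat) : fps int :=
  FPS (fun n => (\prod_(1 <= m < n.+1) (1 - q ^+ (m * r))) n).

Fact E_unit r : E r \is a GRing.unit.
Proof. by rewrite unfold_in /= /fps_unit /= big_geq. Qed.

(* A k-colored partition of n is given by the multiplicity f (p, c) of the part
   p.+1 in the color c; parts and multiplicities are automatically at most n. *)
Definition RD (k l t n : nat) : nat :=
  #|[set f : {ffun 'I_n * 'I_k -> 'I_n.+1} |
      [&& (\sum_(pc : 'I_n * 'I_k) pc.1.+1 * f pc == n)%N,
          [forall pc : 'I_n * 'I_k, (l %| pc.1.+1)%N ==> (f pc == 0 :> nat)%N] &
          [forall pc, f pc < t]%N]]|.

Definition H3 (f : fps int) : fps int :=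
  FPS (fun n => if (3 %| n)%N then f n else 0).

(* The Laurent series zeta = E_1^3 / (q E_9^3) and T = E_3^12 / (q^3 E_9^12)
   enter only through their negative powers, which are power series. *)
Definition zetaV : fps int := q * E 9 ^+ 3 / E 1 ^+ 3.
Definition TV : fps int := q ^+ 3 * E 9 ^+ 12 / E 3 ^+ 12.

(* Matrices and vectors are indexed from 1; entries of index 0 are not used. *)
Definition is_M (m : nat -> nat -> int) : Prop :=
  (forall i, (1 <= i)%N ->
     H3 (zetaV ^+ i) = \sum_(1 <= j < i.+1) (m i j)%:~R * TV ^+ j) /\
  (forall i j, (1 <= i < j)%N -> m i j = 0).

(* M is the matrix satisfying is_M: its entries of positive index are determined
   by is_M, as TV ^+ j = q^(3j) + (terms of higher degree). *)
Definition M : nat -> nat -> int := xget (fun _ _ => 0) [set m | is_M m]%classic.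

Definition A (i j : nat) : int := M (4 * i - 2) (i + j - 1).

(* \sum_(i \in _) is the sum of a finitely supported family (0 otherwise); for
   v = x k, the support of i |-> v i * B i j is finite because that of v is. *)
Definition row_mul (v : nat -> int) (B : nat -> nat -> int) : nat -> int :=
  fun j => \sum_(i \in [set i : nat | (1 <= i)%N]%classic) v i * B i j.

Definition x (k : nat) : nat -> int :=
  iter k.-1 (fun v => row_mul v A) (fun i => if i == 1%N then 9 else 0).

(* Main.v *)
Require Import Defs.
From HB Require Import structures.
From mathcomp Require Import all_boot all_order all_algebra.
From mathcomp Require Import boolp classical_sets fsbigop.
From mathcomp Require Import zify ring.

(** Put zeta = E_1^3 / (q E_9^3) and T = E_3^12 / (q^3 E_9^12). Up to a power of
    q^3 and of E_9/E_3, which H_3 leaves alone, q^2 times the term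
      q^(i-1) (E_3/E_1)^(3(4i-2))
    is zeta^-(4i-2), and T^-(i+j-1) is, up to the same factor, q^3 times the j-th
    such term with q replaced by q^3. So picking the coefficients of index 3n + 1
    in the identity for k replaces the i-th term by the combination of terms
    given by row i of A ([H3_eta_term]), and these are the coefficients counted
    for k + 1. The case k = 1 is the expansion H_3(zeta^-1) = 9 T^-1 applied to
    the generating function (E_3^2 / (E_1 E_9))^3 ([RD_gf]), which is obtained by
    distributing a product of trinomials 1 + q^m + q^(2m) over sums, so that the
    multiplicity functions become the summands.

    What makes this work is that H_3(zeta^-i) is a polynomial in T^-1 at all,
    i.e. that M exists. It rests on two facts.
    - Jacobi's identity E_1^3 = sum_k (-1)^k (2k+1) q^(k(k+1)/2) ([jacobi]),
      obtained as the limit of a finite identity proved by induction, shows that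
      E_1^3 = P - 3 q E_9^3 with P a series in q^3 ([E1_cube]).
    - The product over the cube roots of unity w of E_1(wq) is E_3^4 / E_9
      ([norm3_E1]).
    Computing the product over w of E_1(wq)^3 in both ways gives
    P^3 - 27 q^3 E_9^9 = E_3^12 / E_9^3, which is the modular equation
    T = zeta^3 + 9 zeta^2 + 27 zeta ([zetaV_cubic]). It reduces H_3(zeta^-i) to
    the cases i < 3, which follow from the dissection, and shows that the rows
    of M obey a recurrence of order three. Since H_3(zeta^-i) has order at least
    i in q, row i of M vanishes in the columns j with 3j < i ([M_lt]); this is
    why only non-negative powers of q appear in the result. *)

Set Implicit Arguments.
Unset Strict Implicit.
Unset Printing Implicit Defensive.

Import GRing.Theory.
Local Open Scope ring_scope.

(** * Congruence modulo powers of q *)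

Definition eqmodq (N : nat) (f g : fps int) := forall n, (n < N)%N -> f n = g n.

Lemma eqmodq_refl N f : eqmodq N f f.
Proof. by []. Qed.

Lemma eqmodq_sym N f g : eqmodq N f g -> eqmodq N g f.
Proof. by move=> fg n /fg. Qed.

Lemma eqmodq_trans N f g h : eqmodq N f g -> eqmodq N g h -> eqmodq N f h.
Proof. by move=> fg gh n ltn; rewrite fg ?gh. Qed.

Lemma eqmodq_leq M N f g : (M <= N)%N -> eqmodq N f g -> eqmodq M f g.
Proof. by move=> leMN fg n ltn; apply/fg/(leq_trans ltn). Qed.

Lemma eqmodq_eq f g : (forall N, eqmodq N f g) -> f = g.
Proof. by move=> fg; apply: fpsP => n; apply: (fg n.+1). Qed.

Lemma eqmodqM N f f' g g' :
  eqmodq N f f' -> eqmodq N g g' -> eqmodq N (f * g) (f' * g').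
Proof.
move=> ff gg n ltn; rewrite !fps_coefM; apply: eq_bigr => i _.
by rewrite ff ?gg //; have := ltn_ord i; lia.
Qed.

Lemma eqmodqD N f f' g g' :
  eqmodq N f f' -> eqmodq N g g' -> eqmodq N (f + g) (f' + g').
Proof. by move=> ff gg n ltn; rewrite !fps_coefD ff ?gg. Qed.

Lemma eqmodqB N f f' g g' :
  eqmodq N f f' -> eqmodq N g g' -> eqmodq N (f - g) (f' - g').
Proof. by move=> ff gg n ltn; rewrite !fps_coefB ff ?gg. Qed.

Lemma eqmodqX N f g k : eqmodq N f g -> eqmodq N (f ^+ k) (g ^+ k).
Proof.
move=> fg; elim: k => [|k IHk]; first exact: eqmodq_refl.
by rewrite !exprS; apply: eqmodqM.
Qed.

Lemma eqmodq_sum N I (r : seq I) (P : pred I) (F G : I -> fps int) :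
  (forall i, P i -> eqmodq N (F i) (G i)) ->
  eqmodq N (\sum_(i <- r | P i) F i) (\sum_(i <- r | P i) G i).
Proof.
by move=> FG n ltn; rewrite !fps_coef_sum; apply: eq_bigr => i /FG; apply.
Qed.

Lemma eqmodq_prod N I (r : seq I) (P : pred I) (F G : I -> fps int) :
  (forall i, P i -> eqmodq N (F i) (G i)) ->
  eqmodq N (\prod_(i <- r | P i) F i) (\prod_(i <- r | P i) G i).
Proof.
move=> FG; apply: (big_ind2 (eqmodq N)) => // f f' g g'; exact: eqmodqM.
Qed.

Lemma coef_qM (f : fps int) n : (q * f) n = if n is n'.+1 then f n' else 0.
Proof.
rewrite fps_coefM; case: n => [|n].
  by rewrite big_ord1 /q /= mul0r.
rewrite big_ord_recl big_ord_recl big1 => [|i _] /=; last by rewrite mul0r.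
by rewrite mul0r mul1r add0r addr0 subn1.
Qed.

Lemma coef_qXM m (f : fps int) n :
  (q ^+ m * f) n = if (m <= n)%N then f (n - m)%N else 0.
Proof.
elim: m n => [|m IHm] n; first by rewrite mul1r subn0.
by rewrite exprS -mulrA coef_qM; case: n => [|n] //; rewrite IHm subSS.
Qed.

Lemma coef_qX m n : (q ^+ m) n = (n == m)%:R.
Proof.
rewrite -[q ^+ m]mulr1 coef_qXM fps_coef1.
case: leqP => h; first by congr (_%:R); lia.
by rewrite (_ : (n == m) = false) //; lia.
Qed.

Lemma coefM_int (f : fps int) (z : int) n : (f * z%:~R) n = f n * z.
Proof.
rewrite mulrzr; have fN k : (f *+ k) n = f n *+ k.
  by elim: k => // k IHk; rewrite !mulrS fps_coefD IHk.
case: z => k; first by rewrite -pmulrn fN -mulr_natr natz.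
rewrite NegzE mulrNz mulrN -pmulrn; transitivity (- ((f *+ k.+1) n)) => //.
by rewrite fN -mulr_natr natz.
Qed.

Lemma qX_inj m : injective (fun f : fps int => q ^+ m * f).
Proof.
move=> f g /= fg; apply: fpsP => n.
have : (q ^+ m * f) (n + m)%N = (q ^+ m * g) (n + m)%N by rewrite fg.
by rewrite !coef_qXM leq_addl addnK.
Qed.

Lemma eqmodq_qXM N m f g : eqmodq (N - m) f g -> eqmodq N (q ^+ m * f) (q ^+ m * g).
Proof.
by move=> fg n ltn; rewrite !coef_qXM; case: leqP => // h; apply: fg; lia.
Qed.

Lemma eqmodq_1subqX N m : (N <= m)%N -> eqmodq N (1 - q ^+ m) 1.
Proof.
move=> leNm n ltn; rewrite fps_coefB coef_qX.
by rewrite (_ : (n == m) = false) ?subr0 //; lia.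
Qed.

(** A truncated product of factors 1 - q^(mr) is already stable modulo q^(N+1)
    once it contains the factors with m <= N; the predicate P selects a
    subproduct, such as the one over the multiples of 3. *)
Lemma prod_1subqX_trunc N r B (P : pred nat) : (0 < r)%N -> (N <= B)%N ->
  eqmodq N.+1 (\prod_(1 <= m < B.+1 | P m) (1 - q ^+ (m * r)))
           (\prod_(1 <= m < N.+1 | P m) (1 - q ^+ (m * r))).
Proof.
move=> r0 /subnK <-; elim: (B - N)%N => [|d IHd]; first exact: eqmodq_refl.
rewrite addSn big_mkcond big_nat_recr //= -big_mkcond /= -[X in eqmodq _ _ X]mulr1.
apply: eqmodqM => //; case: (P _) => //; apply: eqmodq_1subqX.
by rewrite (leq_trans _ (leq_pmulr _ r0)) // ltnS leq_addl.
Qed.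

Lemma E_trunc N r B : (0 < r)%N -> (N <= B.+1)%N ->
  eqmodq N (E r) (\prod_(1 <= m < B.+1) (1 - q ^+ (m * r))).
Proof.
move=> r0 leNB n ltnN.
by rewrite (@prod_1subqX_trunc n r B predT r0) // -ltnS (leq_trans ltnN).
Qed.

Lemma prod_mul3_mkcond N (F : nat -> fps int) :
  \prod_(1 <= m < N.+1 | (3 %| m)%N) F m =
  \prod_(1 <= m < N.+1) (if (3 %| m)%N then F m else 1).
Proof. exact: big_mkcond. Qed.

(** E_(3r) is also the product of the factors of E_r of index divisible by 3.
    In this form it can be compared with E_r factor by factor. *)
Lemma E_mul3_trunc N r : (0 < r)%N ->
  eqmodq N.+1 (E (3 * r)) (\prod_(1 <= m < N.+1 | (3 %| m)%N) (1 - q ^+ (m * r))).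
Proof.
move=> r0.
apply: (@eqmodq_trans _ _ (\prod_(1 <= m < N.+1) (1 - q ^+ (m * (3 * r))))).
  by apply: E_trunc => //; lia.
apply: (@eqmodq_trans _ _
  (\prod_(1 <= m < (3 * N).+1 | (3 %| m)%N) (1 - q ^+ (m * r)))); last first.
  by apply: prod_1subqX_trunc => //; lia.
rewrite (_ : \prod_(1 <= m < (3 * N).+1 | _) _ =
   \prod_(1 <= m < N.+1) (1 - q ^+ (m * (3 * r)))); first exact: eqmodq_refl.
elim: N => [|N IHN]; first by rewrite !big_geq.
rewrite (_ : (3 * N.+1).+1 = (3 * N).+4); last by lia.
(* the block 3N+1, 3N+2, 3N+3 of indices contributes only its last factor *)
rewrite [RHS]big_nat_recr //= -IHN big_mkcond [in RHS]big_mkcond /=.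
do 3 rewrite big_nat_recr //=.
rewrite ifN ?mulr1; last by lia.
rewrite ifN ?mulr1; last by lia.
rewrite ifT; last by lia.
by congr (_ * (1 - q ^+ _)); lia.
Qed.

(** * The substitution q -> q^3 *)

Definition dil (f : fps int) : fps int :=
  FPS (fun n => if (3 %| n)%N then f (n %/ 3)%N else 0).

Lemma dil_coef f n : dil f n = if (3 %| n)%N then f (n %/ 3)%N else 0.
Proof. by []. Qed.

Fact dil_zmod : zmod_morphism dil.
Proof.
by move=> f g; apply: fpsP => n /=; case: ifP; rewrite ?subr0.
Qed.

(** Truncation reduces the product to that of polynomials, where the
    substitution is composition with X^3. *)
Fact dil_monoid : monoid_morphism dil.
Proof.
split=> [|f g]; apply: fpsP => n.
  rewrite /=; case: ifP => h; first by congr (_%:R); lia.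
  by rewrite (_ : (n == 0%N) = false) //; lia.
have dilE (h : fps int) i : (i < n.+1)%N -> 
    dil h i = (fps_trunc n.+1 h \Po 'X^3)`_i.
  move=> lti; rewrite coef_comp_poly_Xn //= coef_fps_trunc //.
  exact: leq_ltn_trans (leq_div _ _) _.
rewrite fps_coefM.
transitivity (((fps_trunc n.+1 f \Po 'X^3) * (fps_trunc n.+1 g \Po 'X^3))`_n).
  rewrite -comp_polyM coef_comp_poly_Xn //=; case: ifP => // _.
  by rewrite -coef_fps_mul // ltnS leq_div.
rewrite coefM; apply: eq_bigr => i _.
by rewrite !dilE // ltnS leq_subr.
Qed.

HB.instance Definition _ := GRing.isZmodMorphism.Build _ _ dil dil_zmod.
HB.instance Definition _ := GRing.isMonoidMorphism.Build _ _ dil dil_monoid.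

Lemma dil_int z : dil z%:~R = z%:~R.
Proof. exact: rmorph_int. Qed.

Lemma dil_inj : injective dil.
Proof.
move=> f g fg; apply: fpsP => n.
have := congr1 (fun h : fps int => h (3 * n)%N) fg.
by rewrite /= dvdn_mulr // mulKn.
Qed.

Lemma dil_q : dil q = q ^+ 3.
Proof.
apply: fpsP => n; rewrite coef_qX /=; case: ifP => h; first by congr (_%:R); lia.
by rewrite (_ : (n == 3%N) = false) //; lia.
Qed.

Lemma dil_E r : (0 < r)%N -> dil (E r) = E (3 * r).
Proof.
move=> r0; apply: eqmodq_eq => N.
apply: eqmodq_trans (eqmodq_sym (@E_trunc N (3 * r) N _ _)) => //; try lia.
apply: (@eqmodq_trans _ _ (dil (\prod_(1 <= m < N.+1) (1 - q ^+ (m * r))))).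
  move=> n ltn /=; case: ifP => // _; apply: (@E_trunc N) => //.
  exact: leq_ltn_trans (leq_div _ _) _.
rewrite rmorph_prod (_ : \prod_(_ <= _ < _) _ =
  \prod_(1 <= m < N.+1) (1 - q ^+ (m * (3 * r)))); first exact: eqmodq_refl.
by apply: eq_bigr => m _; rewrite rmorphB rmorph1 rmorphXn /= dil_q -exprM mulnCA.
Qed.

(** * Jacobi's identity for the cube of Euler's product *)

(** The q-Pochhammer symbol (q; q)_n. *)
Definition poch (n : nat) : fps int := \prod_(1 <= m < n.+1) (1 - q ^+ m).

Lemma poch0 : poch 0 = 1.
Proof. by rewrite /poch big_geq. Qed.

Lemma pochS n : poch n.+1 = poch n * (1 - q ^+ n.+1).
Proof. by rewrite /poch big_nat_recr. Qed.

Lemma poch_unit n : poch n \is a GRing.unit.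
Proof.
elim: n => [|n IHn]; first by rewrite poch0 unitr1.
rewrite pochS unitrM IHn unfold_in /= /fps_unit fps_coefB coef_qX subr0.
exact: unitr1.
Qed.

Lemma E1_poch n : eqmodq n.+1 (E 1) (poch n).
Proof.
rewrite (_ : poch n = \prod_(1 <= m < n.+1) (1 - q ^+ (m * 1))).
  exact: E_trunc.
by apply: eq_bigr => m _; rewrite muln1.
Qed.

Lemma poch_trunc n m : (n <= m)%N -> eqmodq n.+1 (poch m) (poch n).
Proof.
move=> lenm; apply: (@eqmodq_trans _ _ (E 1)); last exact: E1_poch.
by apply: (@eqmodq_leq _ m.+1) => //; apply/eqmodq_sym/E1_poch.
Qed.

(** 1 / (q; q)_(n-k), read as 0 for k > n. With this convention the recurrence
    [pochVS] also holds at the boundary k = n + 1, where its factor 1 - q^0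
    vanishes. *)
Definition pochV (n k : nat) : fps int :=
  if (k <= n)%N then (poch (n - k))^-1 else 0.

Lemma pochVS n k : (k <= n.+1)%N ->
  pochV n k = (1 - q ^+ (n.+1 - k)) * pochV n.+1 k.
Proof.
move=> lekn; rewrite /pochV lekn; case: leqP => [lekn'|ltnk].
  rewrite subSn // pochS invrM ?poch_unit //; last first.
    by have := poch_unit (n - k).+1; rewrite pochS unitrM => /andP[].
  rewrite mulrA mulrV ?mul1r //.
  by have := poch_unit (n - k).+1; rewrite pochS unitrM => /andP[].
by rewrite (_ : n.+1 - k = 0)%N ?expr0 ?subrr ?mul0r //; lia.
Qed.

(** (-1)^k q^(k(k+1)/2) [2n+1, n-k], with a Gaussian binomial coefficient: up to
    sign and shift, the coefficients in z of
      (1 - z q^0) ... (1 - z q^n) (z - q) ... (z - q^n).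
    As a function c(k) of an integer k this satisfies c(-1-k) = - c(k). *)
Definition jacobi_coef (n k : nat) : fps int :=
  (-1) ^+ k * q ^+ 'C(k.+1, 2) * poch (2 * n).+1 * pochV n k
  * (poch (n + k).+1)^-1.

(** The coefficient of index k - 1; for k = 0 the antisymmetry k <-> -1-k gives
    its value as - jacobi_coef n 0. *)
Definition jacobi_coef_pred (n k : nat) : fps int :=
  if k is k'.+1 then jacobi_coef n k' else - jacobi_coef n 0.

Lemma invr_poch n : (poch n)^-1 = (1 - q ^+ n.+1) * (poch n.+1)^-1.
Proof.
have := poch_unit n.+1; rewrite pochS unitrM => /andP[_ Uq].
by rewrite invrM ?poch_unit // mulrA mulrV // mul1r.
Qed.

(** Passing from n to n + 1 multiplies the polynomial in z above by
    (1 - z q^(n+1)) (z - q^(n+1)); this is the resulting recurrence for its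
    coefficients. Everything is expressed through d = q^(n+1-k) and b = q^k,
    which turns the claim into a polynomial identity in q, d and b. *)
Lemma jacobi_coef_rec n k : (k <= n.+1)%N ->
  jacobi_coef n.+1 k = (1 + q ^+ (2 * n.+1)) * jacobi_coef n k
               - q ^+ n.+1 * (jacobi_coef_pred n k + jacobi_coef n k.+1).
Proof.
move=> lekn.
set d := q ^+ (n.+1 - k); set b := q ^+ k.
set V := pochV n.+1 k; set W := (poch (n + k).+2)^-1; set P := poch (2 * n).+1.
set t := (-1) ^+ k * q ^+ 'C(k.+1, 2).
have qn : q ^+ n.+1 = d * b by rewrite -exprD subnK.
have q2n : q ^+ (2 * n.+1) = (d * b) ^+ 2 by rewrite -qn -exprM mulnC.
have W1 : (poch (n + k).+1)^-1 = (1 - q * d * b ^+ 2) * W.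
  rewrite invr_poch; congr ((1 - _) * _).
  by rewrite (_ : (n + k).+2 = 1 + (n.+1 - k) + k * 2)%N ?exprD ?exprM //; lia.
have W2 : (poch (n + k))^-1 = (1 - d * b ^+ 2) * (1 - q * d * b ^+ 2) * W.
  rewrite invr_poch W1 mulrA; congr ((1 - _) * _ * _).
  by rewrite (_ : (n + k).+1 = (n.+1 - k) + k * 2)%N ?exprD ?exprM //; lia.
have jS : jacobi_coef n.+1 k =
    t * P * (1 - (d * b) ^+ 2) * (1 - q * (d * b) ^+ 2) * V * W.
  rewrite /jacobi_coef -/t -/V addSn -/W (_ : poch (2 * n.+1).+1 =
    P * (1 - (d * b) ^+ 2) * (1 - q * (d * b) ^+ 2)).
    by ring.
  by rewrite pochS exprS q2n; congr (_ * _); rewrite mulnS pochS -q2n mulnS.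
have j0 : jacobi_coef n k = t * P * (1 - d) * (1 - q * d * b ^+ 2) * V * W.
  rewrite /jacobi_coef -/t -/P W1 pochVS // -/d -/V; ring.
have jP : b * jacobi_coef_pred n k =
    - t * P * (1 - d * b ^+ 2) * (1 - q * d * b ^+ 2) * V * W.
  have [k0|[k' kE]] : k = 0%N \/ exists k', k = k'.+1.
    by case: (k) => [|k']; [left | right; exists k'].
    have b1 : b = 1 by rewrite /b k0.
    have -> : jacobi_coef_pred n k = - jacobi_coef n k by rewrite k0.
    by rewrite j0 b1; ring.
  have tE : t = - (-1) ^+ k' * q ^+ 'C(k'.+1, 2) * b.
    by rewrite /t /b kE binS bin1 exprD exprS; ring.
  have VE : pochV n k' = V by rewrite /V kE /pochV ltnS subSS.
  have -> : jacobi_coef_pred n k = jacobi_coef n k' by rewrite kE.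
  rewrite /jacobi_coef -/P VE (_ : (n + k').+1 = n + k)%N; last by rewrite kE addnS.
  by rewrite W2 tE; ring.
(* multiplied by q, so that the factor 1 - q^(n-k) = 1 - d / q becomes q - d *)
have jN : q * pochV n k.+1 = (q - d) * (1 - d) * V.
  rewrite /V /d; case: (ltngtP k n.+1) lekn => // [ltkn|->] _; last first.
    rewrite subnn expr0 subrr mulr0 mul0r /pochV ifN ?mulr0 //; lia.
  rewrite -mulrA -pochVS; last by lia.
  have := @pochVS n k.+1 ltkn.
  rewrite [pochV n.+1 k.+1]/pochV ltnS subSS -/(pochV n k) => ->.
  rewrite (_ : n.+1 - k = (n - k).+1)%N; last by lia.
  by rewrite exprS; ring.
have jNN : jacobi_coef n k.+1 = - t * P * b * (q - d) * (1 - d) * V * W.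
  rewrite /jacobi_coef -/P binS bin1 exprD !exprS -/b addnS -/W.
  transitivity (- t * b * P * (q * pochV n k.+1) * W); first by rewrite /t; ring.
  by rewrite jN; ring.
rewrite q2n qn (mulrDr (d * b)) -(mulrA d b) jP jNN jS j0; ring.
Qed.

(** For K > n: up to sign, the derivative at z = 1 of the polynomial in z, where
    the antisymmetry k <-> -1-k has been used to keep k >= 0 only. *)
Definition jacobi_sum (n K : nat) : fps int :=
  \sum_(k < K) (2 * k + 1)%:R * jacobi_coef n k.

(** The weights 2k + 1 satisfy (2k - 1) + (2k + 3) = 2 (2k + 1), so summing
    [jacobi_coef_rec] by parts multiplies the sum by
    1 + q^(2n+2) - 2 q^(n+1) = (1 - q^(n+1))^2. *)
Lemma jacobi_sumS n :
  jacobi_sum n.+1 n.+2 = (1 - q ^+ n.+1) ^+ 2 * jacobi_sum n n.+1.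
Proof.
(* summation by parts; the last two terms are the boundary contribution *)
have nb K :
    \sum_(k < K.+1) (2 * k + 1)%:R *
      (jacobi_coef_pred n k + jacobi_coef n k.+1) =
    2 * jacobi_sum n K.+1 + (2 * K + 1)%:R * jacobi_coef n K.+1 -
    (2 * K + 3)%:R * jacobi_coef n K.
  rewrite /jacobi_sum; elim: K => [|K IHK]; first by rewrite !big_ord1 /=; ring.
  rewrite big_ord_recr IHK [in RHS]big_ord_recr /=.
  rewrite !mulnS !natrD; ring.
have jac0 k : (n < k)%N -> jacobi_coef n k = 0.
  by move=> ltnk; rewrite /jacobi_coef /pochV leqNgt ltnk mulr0 mul0r.
have cutE : jacobi_sum n n.+2 = jacobi_sum n n.+1.
  by rewrite /jacobi_sum big_ord_recr /= jac0 // mulr0 addr0.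
rewrite /jacobi_sum.
under eq_bigr => k _ do rewrite jacobi_coef_rec -1?ltnS //.
transitivity ((1 + q ^+ (2 * n.+1)) * jacobi_sum n n.+2 -
  q ^+ n.+1 * \sum_(k < n.+2) (2 * k + 1)%:R *
    (jacobi_coef_pred n k + jacobi_coef n k.+1)).
  rewrite /jacobi_sum !mulr_sumr -sumrB; apply: eq_bigr => k _; ring.
by rewrite nb !jac0 // cutE mulnC exprM /jacobi_sum; ring.
Qed.

(** A finite form of Jacobi's identity; multiplying by E_1 and letting n tend to
    infinity gives [jacobi]. *)
Lemma finite_jacobi n : jacobi_sum n n.+1 = poch n ^+ 2.
Proof.
elim: n => [|n IHn]; last by rewrite jacobi_sumS IHn pochS; ring.
rewrite /jacobi_sum big_ord1 /jacobi_coef /pochV /= !poch0 invr1 muln0 addn0.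
by transitivity (poch 1 / poch 1); [ring | rewrite mulrV ?poch_unit // expr1n].
Qed.

Definition jacobi_series : fps int :=
  FPS (fun n => \sum_(k < n.+1)
    (if n == 'C(k.+1, 2) then (-1) ^+ k * (2 * k + 1)%:R else 0)).

Lemma leq_bin2 k : (k <= 'C(k.+1, 2))%N.
Proof. by rewrite binS bin1 leq_addl. Qed.

Lemma jacobi_seriesE n B : (n < B)%N ->
  jacobi_series n =
  \sum_(k < B) (if n == 'C(k.+1, 2) then (-1) ^+ k * (2 * k + 1)%:R else 0).
Proof.
move=> ltnB; rewrite /= (big_ord_widen B
  (fun k => if n == 'C(k.+1, 2) then (-1) ^+ k * (2 * k + 1)%:R else 0)) //.
rewrite big_mkcond; apply: eq_bigr => k _ /=; case: ifP => //.
case: eqP => // ->; have := leq_bin2 k; lia.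
Qed.

(** In E_1 (q; q)_n^2, the k-th term of [finite_jacobi] is
    (-1)^k (2k+1) q^(k(k+1)/2) times a series congruent to 1 modulo q^(n-k+1),
    and k(k+1)/2 >= k, so the congruence holds modulo q^(n+1). *)
Lemma jacobi : E 1 ^+ 3 = jacobi_series.
Proof.
apply: eqmodq_eq => n; apply: (@eqmodq_leq _ n.+1) => //.
apply: (@eqmodq_trans _ _ (E 1 * poch n ^+ 2)).
  by rewrite exprS; apply/eqmodqM/eqmodqX/E1_poch.
rewrite -finite_jacobi /jacobi_sum mulr_sumr.
apply: (@eqmodq_trans _ _
  (\sum_(k < n.+1) q ^+ 'C(k.+1, 2) * ((-1) ^+ k * (2 * k + 1)%:R))).
  apply: eqmodq_sum => k _.
  rewrite (_ : E 1 * _ = q ^+ 'C(k.+1, 2) * ((E 1 * pochV n k) *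
     (poch (2 * n).+1 * (poch (n + k).+1)^-1) *
     ((-1) ^+ k * (2 * k + 1)%:R))); last first.
    by rewrite /jacobi_coef; ring.
  apply: eqmodq_qXM; rewrite -[X in eqmodq _ _ X]mul1r; apply: eqmodqM => //.
  have lekn : (k <= n)%N by rewrite -ltnS.
  rewrite -[X in eqmodq _ _ X]mul1r; apply: eqmodqM.
    rewrite -(mulrV (poch_unit (n - k))) /pochV lekn.
    apply: eqmodqM => //; apply: eqmodq_leq (@E1_poch (n - k)).
    by have := leq_bin2 k; lia.
  rewrite -(mulrV (poch_unit (n + k).+1)); apply: eqmodqM => //.
  by apply: eqmodq_leq (@poch_trunc (n + k).+1 _ _); lia.
move=> i ltin; rewrite (jacobi_seriesE ltin) fps_coef_sum.
apply: eq_bigr => k _.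
rewrite (_ : (-1) ^+ k * _ = ((-1) ^+ k * (2 * k + 1)%:R)%:~R); last first.
  by rewrite rmorphM rmorphXn /= rmorphN rmorph1 rmorph_nat.
by rewrite coefM_int coef_qX; case: eqP; rewrite ?mul1r ?mul0r.
Qed.

(** * Components modulo 3 *)

Definition part (r : nat) (f : fps int) : fps int :=
  FPS (fun n => if n == r %[mod 3] then f n else 0).

Lemma part_coef r f n : part r f n = if n == r %[mod 3] then f n else 0.
Proof. by []. Qed.

Definition homog (r : nat) (f : fps int) := part r f = f.

Fact part_zmod r : zmod_morphism (part r).
Proof. by move=> f g; apply: fpsP => n /=; case: ifP; rewrite ?subr0. Qed.

HB.instance Definition _ r :=
  GRing.isZmodMorphism.Build _ _ (part r) (part_zmod r).

Lemma partD r f g : part r (f + g) = part r f + part r g.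
Proof. exact: raddfD. Qed.

Lemma H3E f : H3 f = part 0 f.
Proof. by []. Qed.

Lemma part_sum f : f = part 0 f + part 1 f + part 2 f.
Proof.
apply: fpsP => n; rewrite !fps_coefD /=.
have : (n %% 3 < 3)%N by rewrite ltn_mod.
by case: (n %% 3)%N => [|[|[|m]]] // _; rewrite /= ?addr0 ?add0r.
Qed.

Lemma homog_coef r f n : homog r f -> (n %% 3 != r %% 3)%N -> f n = 0.
Proof. by move=> <- /= /negbTE ->. Qed.

Lemma homog_part r f : homog r (part r f).
Proof. by rewrite /homog; apply: fpsP => n /=; case: eqP. Qed.

Lemma part_homog r s f : homog s f ->
  part r f = if s == r %[mod 3] then f else 0.
Proof.
move=> <-; case: eqP => sr; apply: fpsP => n /=; first by rewrite sr; case: eqP.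
by case: eqP => // nr; case: eqP => // ns; case: sr; rewrite -nr -ns.
Qed.

Lemma homogM r s f g : homog r f -> homog s g -> homog (r + s) (f * g).
Proof.
move=> hf hg; apply: fpsP => n /=; case: eqP => // nrs.
rewrite big1 // => i _.
have [ir|ir] := eqVneq (i %% 3)%N (r %% 3)%N; last first.
  by rewrite (homog_coef hf) ?mul0r.
rewrite (homog_coef hg) ?mulr0 //; have := ltn_ord i; lia.
Qed.

Lemma homog1 : homog 0 1.
Proof. by apply: fpsP => -[|n] //=; case: ifP. Qed.

Lemma homogX k r f : homog r f -> homog (k * r) (f ^+ k).
Proof.
move=> hf; elim: k => [|k IHk]; first exact: homog1.
by rewrite exprS mulSn; apply: homogM.
Qed.

Lemma homog_q : homog 1 q.
Proof. by apply: fpsP => -[|[|n]] //=; case: ifP. Qed.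

Lemma homog_dil f : homog 0 (dil f).
Proof. by apply: fpsP => n /=; rewrite mod0n /dvdn; case: eqP. Qed.

Lemma partM r s t f g :
  part r (part s f * part t g) =
  if (s + t == r %[mod 3]) then part s f * part t g else 0.
Proof. by apply/part_homog/homogM; apply: homog_part. Qed.

(** In particular H_3 is linear over the series in q^3. *)
Lemma part_dilM r f g : part r (dil f * g) = dil f * part r g.
Proof.
apply: fpsP => n; rewrite fps_coefM [LHS]/= -/(dil f).
have [nr|nr] := eqVneq (n %% 3)%N (r %% 3)%N.
  apply: eq_bigr => i _ /=; case: ifP; rewrite ?mul0r // => i3.
  by rewrite ifT //; have := ltn_ord i; lia.
rewrite big1 // => i _ /=; case: ifP; rewrite ?mul0r // => i3.
by rewrite ifN ?mulr0 //; have := ltn_ord i; lia.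
Qed.

(** The product of f(w q) over the three cube roots of unity w, written through
    the components of f so that no root of unity has to be adjoined. *)
Definition norm3 (f : fps int) : fps int :=
  part 0 f ^+ 3 + part 1 f ^+ 3 + part 2 f ^+ 3
  - 3 * part 0 f * part 1 f * part 2 f.

Lemma norm3M : {morph norm3 : f g / f * g}.
Proof.
move=> f g; rewrite /norm3.
have E r : part r (f * g) = part r (
    part 0 f * part 0 g + part 0 f * part 1 g + part 0 f * part 2 g +
    part 1 f * part 0 g + part 1 f * part 1 g + part 1 f * part 2 g +
    part 2 f * part 0 g + part 2 f * part 1 g + part 2 f * part 2 g).
  by congr part; rewrite [in LHS](part_sum f) [in LHS](part_sum g); ring.
by rewrite !E !raddfD /= !partM /= !add0r !addr0; ring.
Qed.

Lemma norm3_homog0 f : homog 0 f -> norm3 f = f ^+ 3.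
Proof.
move=> hf; rewrite /norm3.
rewrite (part_homog 0 hf) (part_homog 1 hf) (part_homog 2 hf) /=; ring.
Qed.

Lemma norm3_1subqX m :
  norm3 (1 - q ^+ m) =
  if (3 %| m)%N then (1 - q ^+ m) ^+ 3 else 1 - q ^+ (m * 3).
Proof.
have hq : homog m (q ^+ m) by rewrite -{1}[m]muln1; apply/homogX/homog_q.
case: ifP => m3.
  apply: norm3_homog0; rewrite /homog raddfB /= (part_homog 0 hq) homog1.
  by rewrite ifT //; exact: m3.
rewrite /norm3 !raddfB /= !(part_homog _ hq) !(part_homog _ homog1) /=.
have : (m %% 3 < 3)%N by rewrite ltn_mod.
move: m3; rewrite /dvdn exprM; case: (m %% 3)%N => [|[|[|]]] //= _ _; ring.
Qed.

Lemma eqmodq_norm3 N f g : eqmodq N f g -> eqmodq N (norm3 f) (norm3 g).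
Proof.
move=> fg; have fgp r : eqmodq N (part r f) (part r g).
  by move=> n ltn /=; case: ifP => // _; apply: fg.
apply: eqmodqB; first by do 2 ?[apply: eqmodqD]; apply: eqmodqX.
by do 3 ?[apply: eqmodqM].
Qed.

(** Factor by factor: the norm of 1 - q^m is 1 - q^(3m) when 3 does not divide m
    and (1 - q^m)^3 when it does. *)
Lemma norm3_E1 : norm3 (E 1) * E 9 = E 3 ^+ 4.
Proof.
apply: eqmodq_eq => N; apply: (@eqmodq_leq _ N.+1) => //.
apply: (@eqmodq_trans _ _ (norm3 (\prod_(1 <= m < N.+1) (1 - q ^+ m)) *
    \prod_(1 <= m < N.+1 | (3 %| m)%N) (1 - q ^+ (m * 3)))).
  apply: eqmodqM; last exact: (@E_mul3_trunc N 3).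
  by apply/eqmodq_norm3/E1_poch.
apply: (@eqmodq_trans _ _ ((\prod_(1 <= m < N.+1) (1 - q ^+ (m * 3))) *
    (\prod_(1 <= m < N.+1 | (3 %| m)%N) (1 - q ^+ m)) ^+ 3)); last first.
  rewrite [E 3 ^+ 4]exprS; apply: eqmodqM; first by apply/eqmodq_sym/E_trunc.
  apply/eqmodqX/eqmodq_sym.
  rewrite (eq_bigr (fun m => 1 - q ^+ (m * 1))) => [|m _]; last by rewrite muln1.
  exact: (@E_mul3_trunc N 1).
rewrite (big_morph _ norm3M (_ : norm3 1 = 1)); last first.
  by rewrite norm3_homog0 ?expr1n //; apply: homog1.
rewrite -prodrXl !prod_mul3_mkcond -!big_split /=; apply: eqmodq_prod => m _.
by rewrite norm3_1subqX; case: ifP; rewrite ?mulr1 // mulrC.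
Qed.

(** * The modular equation between zeta and T *)

Lemma big_ord3 (R : nmodType) n (F : nat -> R) :
  \sum_(k < 3 * n) F k =
  \sum_(j < n) (F (3 * j)%N + F (3 * j).+1 + F (3 * j).+2).
Proof.
elim: n => [|n IHn]; first by rewrite !big_ord0.
by rewrite mulnS /= !big_ord_recr /= IHn !addrA.
Qed.

Lemma bin2_double k : (2 * 'C(k.+1, 2) = k * k.+1)%N.
Proof. by elim: k => // k IHk; rewrite binS bin1 mulnDr IHk; lia. Qed.

(** The triangular number k(k+1)/2 is divisible by 3 unless k = 3j + 1, and then
    it is 1 + 9 j(j+1)/2, with sign (-1)^(3j+1) = - (-1)^j and weight
    2k + 1 = 3 (2j + 1). So the component of residue 1 of E_1^3 is a rescaled
    copy of the whole series. *)
Lemma part_jacobi :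
  part 1 (E 1 ^+ 3) = (q * dil (dil (E 1 ^+ 3))) * (-3)%:~R /\
  part 2 (E 1 ^+ 3) = 0.
Proof.
have t0 j : ('C((3 * j).+1, 2) %% 3 = 0)%N by have := bin2_double (3 * j); nia.
have t1 j : ('C((3 * j).+2, 2) = (9 * 'C(j.+1, 2)).+1)%N.
  by have := bin2_double (3 * j).+1; have := bin2_double j; nia.
have t2 j : ('C((3 * j).+3, 2) %% 3 = 0)%N by have := bin2_double (3 * j).+2; nia.
have jE n : (n %% 3 != 0)%N -> jacobi_series n =
    (\sum_(j < n.+1)
       if n == (9 * 'C(j.+1, 2)).+1 then (-1) ^+ j * (2 * j + 1)%:R else 0)
    * (-3).
  move=> n3; rewrite (@jacobi_seriesE n (3 * n.+1)); last by lia.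
  rewrite (big_ord3 _
    (fun k => if n == 'C(k.+1, 2) then (-1) ^+ k * (2 * k + 1)%:R else 0)).
  rewrite mulr_suml; apply: eq_bigr => j _.
  rewrite ifN ?add0r; last by have := t0 j; lia.
  rewrite addrC ifN ?add0r; last by have := t2 j; lia.
  rewrite t1; case: ifP => _; rewrite ?mul0r // exprS exprM.
  rewrite (_ : (2 * (3 * j).+1 + 1)%:R = 3 * (2 * j + 1)%:R :> int); last by lia.
  by rewrite (_ : (-1) ^+ 3 = -1 :> int) //; ring.
rewrite jacobi; split; apply: fpsP => n; last first.
  rewrite part_coef; case: eqP => // n2.
  rewrite jE; last by rewrite n2.
  by rewrite big1 ?mul0r // => j _; rewrite ifN //; lia.
rewrite coefM_int coef_qM.
case: n => [|n] //; rewrite part_coef !dil_coef; case: eqP => n1; last first.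
  by rewrite ifN ?mul0r //; lia.
rewrite jE; last by rewrite n1.
congr (_ * _); rewrite ifT; last by lia.
case: ifP => n9; last by rewrite big1 // => j _; rewrite ifN //; lia.
rewrite (@jacobi_seriesE _ n.+2); last by lia.
apply: eq_bigr => j _; congr (if _ then _ else _); lia.
Qed.

Lemma dil_dil_E1 : dil (dil (E 1)) = E 9.
Proof. by rewrite !dil_E. Qed.

(** Notation for the dissection E_1^3 = cubeA - 3 cubeB and its norm cubeN; in
    terms of zeta and T, zeta^-1 = cubeB / (cubeA - 3 cubeB) and
    T^-1 = cubeB^3 / cubeN. *)
Definition cubeB : fps int := q * E 9 ^+ 3.
Definition cubeA : fps int := part 0 (E 1 ^+ 3).

Lemma E1_cube : E 1 ^+ 3 = cubeA - 3 * cubeB.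
Proof.
rewrite {1}(part_sum (E 1 ^+ 3)); case: part_jacobi => -> ->.
by rewrite !rmorphXn /= dil_dil_E1 /cubeA /cubeB; ring.
Qed.

Definition cubeN : fps int := cubeA ^+ 3 - 27 * cubeB ^+ 3.

Lemma homog_cubeA : homog 0 cubeA.
Proof. exact: homog_part. Qed.

Lemma homog_cubeB : homog 1 cubeB.
Proof.
by rewrite /cubeB -dil_dil_E1 -!rmorphXn; apply: homogM homog_q (homog_dil _).
Qed.

(** cubeN is the norm of E_1^3 computed from its dissection; [norm3_E1] computes
    the same norm from the product. *)
Lemma cubeN_E9 : cubeN * E 9 ^+ 3 = E 3 ^+ 12.
Proof.
rewrite (_ : cubeN = norm3 (E 1) ^+ 3); last first.
  transitivity (norm3 (E 1 ^+ 3)); last first.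
    by rewrite [E 1 ^+ 3]exprS expr2 !norm3M; ring.
  rewrite /norm3; case: part_jacobi => -> ->.
  by rewrite !rmorphXn /= dil_dil_E1 /cubeN /cubeA /cubeB; ring.
by rewrite -exprMn norm3_E1 -exprM.
Qed.

Lemma cubeN_dil : cubeN = dil (E 1 ^+ 12 / E 3 ^+ 3).
Proof.
apply: (mulIr (unitrX 3 (E_unit 9))).
rewrite cubeN_E9 rmorphM /= rmorphV ?unitrX ?E_unit //.
by rewrite !rmorphXn /= !dil_E // divrK // unitrX // E_unit.
Qed.

Lemma cubeN_unit : cubeN \is a GRing.unit.
Proof.
by have := unitrX 12 (E_unit 3); rewrite -cubeN_E9 unitrM => /andP[].
Qed.

Lemma TV_dil : TV = dil (q * E 3 ^+ 12 / E 1 ^+ 12).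
Proof.
rewrite !rmorphM /= rmorphV ?unitrX ?E_unit //= !rmorphXn /= dil_q !dil_E //.
Qed.

Lemma TV_cubeN : TV * cubeN = cubeB ^+ 3.
Proof.
rewrite /TV /cubeB.
transitivity (q ^+ 3 * E 9 ^+ 9 * (cubeN * E 9 ^+ 3 / E 3 ^+ 12)); first by ring.
by rewrite cubeN_E9 mulrV ?unitrX ?E_unit //; ring.
Qed.

Lemma zetaV_E1 : zetaV * E 1 ^+ 3 = cubeB.
Proof. by rewrite /zetaV divrK // unitrX // E_unit. Qed.

(** The modular equation T = zeta^3 + 9 zeta^2 + 27 zeta: both sides are
    determined by (E_1^3 + 3 cubeB)^3 - 27 cubeB^3 = cubeN. *)
Lemma zetaV_cubic : zetaV ^+ 3 = TV * (1 + 9 * zetaV + 27 * zetaV ^+ 2).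
Proof.
apply: (mulIr (unitrX 3 (unitrX 3 (E_unit 1)))).
rewrite -exprMn zetaV_E1 -TV_cubeN -[RHS]mulrA; congr (TV * _); rewrite /cubeN.
have -> : cubeA = E 1 ^+ 3 + 3 * cubeB by rewrite E1_cube; ring.
by rewrite -zetaV_E1; ring.
Qed.

Lemma part_cubeAB c i k :
  part 0 (c%:R * cubeA ^+ i * cubeB ^+ k) =
  if (3 %| k)%N then c%:R * cubeA ^+ i * cubeB ^+ k else 0.
Proof.
have h : homog k (c%:R * cubeA ^+ i * cubeB ^+ k).
  rewrite -{1}(add0n k) -{1}(muln1 k); apply: homogM (homogX _ homog_cubeB).
  rewrite -(muln0 i) -(add0n (i * 0)%N); apply: homogM (homogX _ homog_cubeA).
  by rewrite -(rmorph_nat dil); apply: homog_dil.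
by rewrite (part_homog 0 h).
Qed.

(** cubeN is a series in q^3, and cubeN zeta^-1 is a polynomial in cubeA and
    cubeB, which lie in residue classes 0 and 1: H_3 keeps the powers of cubeB
    of exponent divisible by 3. *)
Lemma H3_zetaV : H3 zetaV = 9 * TV.
Proof.
apply: (mulrI cubeN_unit); rewrite H3E {1}cubeN_dil -part_dilM -cubeN_dil.
rewrite (_ : cubeN * zetaV =
    1%:R * cubeA ^+ 2 * cubeB ^+ 1 + 3%:R * cubeA ^+ 1 * cubeB ^+ 2
    + 9%:R * cubeA ^+ 0 * cubeB ^+ 3).
  by rewrite !raddfD /= !part_cubeAB /= -TV_cubeN; ring.
apply: (mulIr (unitrX 3 (E_unit 1))).
by rewrite -[LHS]mulrA zetaV_E1 E1_cube /cubeN; ring.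
Qed.

Lemma H3_zetaV2 : H3 (zetaV ^+ 2) = 6 * TV + 243 * TV ^+ 2.
Proof.
apply: (mulrI (unitrX 2 cubeN_unit)).
have cubeNX : cubeN ^+ 2 = dil ((E 1 ^+ 12 / E 3 ^+ 3) ^+ 2).
  by rewrite rmorphXn /= -cubeN_dil.
rewrite H3E {1}cubeNX -part_dilM -cubeNX.
rewrite (_ : cubeN ^+ 2 * zetaV ^+ 2 =
    1%:R * cubeA ^+ 4 * cubeB ^+ 2 + 6%:R * cubeA ^+ 3 * cubeB ^+ 3
    + 27%:R * cubeA ^+ 2 * cubeB ^+ 4 + 54%:R * cubeA ^+ 1 * cubeB ^+ 5
    + 81%:R * cubeA ^+ 0 * cubeB ^+ 6).
  rewrite !raddfD /= !part_cubeAB /=.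
  rewrite (_ : cubeB ^+ 6 = (cubeB ^+ 3) ^+ 2); last by rewrite -exprM.
  have -> : cubeA ^+ 3 = cubeN + 27 * cubeB ^+ 3 by rewrite /cubeN; ring.
  by rewrite -TV_cubeN; ring.
apply: (mulIr (unitrX 2 (unitrX 3 (E_unit 1)))).
by rewrite -[LHS]mulrA -[zetaV ^+ 2 * _]exprMn zetaV_E1 E1_cube /cubeN; ring.
Qed.

(** * The matrix M *)

(** Rows from 0 on, indexed from 0: row 0 stands for H_3(1) = 1, so that the
    recurrence already produces row 3. *)
Fixpoint M_rec (i : nat) : nat -> int :=
  match i with
  | 0 => fun j => (j == 0%N)%:R
  | 1 => fun j => if j == 1%N then 9 else 0
  | 2 => fun j => if j == 1%N then 6 else if j == 2%N then 243 else 0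
  | ((i0.+1 as i1).+1 as i2).+1 =>
      fun j => if j is j'.+1
               then 27 * M_rec i2 j' + 9 * M_rec i1 j' + M_rec i0 j' else 0
  end.

Arguments M_rec : simpl never.

Lemma M_recS i j :
  M_rec i.+3 j.+1 = 27 * M_rec i.+2 j + 9 * M_rec i.+1 j + M_rec i j.
Proof. by []. Qed.

Lemma nat_ind3 (Q : nat -> Prop) : Q 0%N -> Q 1%N -> Q 2%N ->
  (forall i, Q i -> Q i.+1 -> Q i.+2 -> Q i.+3) -> forall i, Q i.
Proof.
move=> Q0 Q1 Q2 QS i; suff : [/\ Q i, Q i.+1 & Q i.+2] by case.
by elim: i => [|i [Qi Qi1 Qi2]]; split=> //; apply: QS.
Qed.

Lemma M_rec_gt i j : (i < j)%N -> M_rec i j = 0.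
Proof.
move: i j; apply: nat_ind3 => [[|j]|[|[|j]]|[|[|[|j]]]|i IH0 IH1 IH2 [|j]] //.
by move=> ltij; rewrite M_recS IH0 ?IH1 ?IH2 //; lia.
Qed.

(** H_3 commutes with multiplication by T^-1, so the modular equation in the form
    zeta^-3 = T^-1 (1 + 9 zeta^-1 + 27 zeta^-2) yields the recurrence. *)
Lemma H3_zetaVX i B : (i < B)%N ->
  H3 (zetaV ^+ i) = \sum_(j < B) (M_rec i j)%:~R * TV ^+ j.
Proof.
move: i B; apply: nat_ind3 => [[|B]|[|[|B]]|[|[|[|B]]]|i IH0 IH1 IH2 [|B]] // ltiB.
- rewrite big_ord_recl big1 => [|j _]; last by rewrite mul0r.
  by rewrite addr0 mulr1 expr0 H3E homog1.
- rewrite expr1 H3_zetaV !big_ord_recl big1 => [|j _]; last by rewrite mul0r.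
  by rewrite /M_rec /=; ring.
- rewrite H3_zetaV2 !big_ord_recl big1 => [|j _]; last by rewrite mul0r.
  by rewrite /M_rec /=; ring.
rewrite big_ord_recl mul0r add0r.
rewrite (_ : zetaV ^+ i.+3 =
    TV * (dil 27 * zetaV ^+ i.+2 + dil 9 * zetaV ^+ i.+1 + zetaV ^+ i)).
  rewrite TV_dil H3E part_dilM !partD !part_dilM -!H3E.
  rewrite (IH0 B) ?(IH1 B) ?(IH2 B); try lia.
  rewrite -TV_dil !mulr_sumr -!big_split mulr_sumr; apply: eq_bigr => j _.
  by rewrite lift0 M_recS !rmorph_nat exprS /=; ring.
rewrite !rmorph_nat (_ : i.+3 = 3 + i)%N // exprD zetaV_cubic !exprS; ring.
Qed.

Lemma is_M_rec : is_M M_rec.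
Proof.
split=> [i i1|i j /andP[_]]; last exact: M_rec_gt.
rewrite (H3_zetaVX (ltnSn i)) big_ord_recl /= big_add1 /= big_mkord.
rewrite (_ : M_rec i 0 = 0) ?mul0r ?add0r //.
by case: i i1 => [|[|[|i]]].
Qed.

Lemma M_spec : is_M M.
Proof.
exact: (@xgetPex _ (fun _ _ => 0) [set m | is_M m]%classic
  (ex_intro _ _ is_M_rec)).
Qed.

Lemma E_modq1 r : eqmodq 1 (E r) 1.
Proof. by move=> -[|] // _; rewrite /= big_geq. Qed.

(** H_3(zeta^-i) is divisible by q^i while T^-j starts with q^(3j), so no T^-j
    with 3j < i can occur. *)
Lemma M_lt i j : (1 <= j)%N -> (3 * j < i)%N -> M i j = 0.
Proof.
elim/ltn_ind: j => j IHj j1 ltji.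
case: M_spec => /(_ i) Mi _.
have {Mi} : H3 (zetaV ^+ i) (3 * j)%N =
    (\sum_(1 <= j' < i.+1) (M i j')%:~R * TV ^+ j') (3 * j)%N by rewrite Mi //; lia.
rewrite /= dvdn_mulr // /zetaV -[q * _ / _]mulrA exprMn coef_qXM leqNgt ltji /=.
rewrite fps_coef_sum; set U := E 9 ^+ 12 / E 3 ^+ 12.
have TVX j' : TV ^+ j' = q ^+ (3 * j') * U ^+ j'.
  by rewrite /TV -mulrA exprMn -exprM.
have U1 : eqmodq 1 (U ^+ j) 1.
  rewrite -[X in eqmodq _ _ X](expr1n _ j); apply: eqmodqX.
  rewrite -(mulrV (unitrX 12 (E_unit 3))); apply: eqmodqM; last exact: eqmodq_refl.
  apply: (@eqmodq_trans _ _ (1 ^+ 12)); first by apply/eqmodqX/E_modq1.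
  by apply/eqmodq_sym/eqmodqX/E_modq1.
rewrite (bigD1_seq j) ?iota_uniq ?mem_index_iota //; last by lia.
rewrite mulrC coefM_int TVX coef_qXM leqnn subnn U1 // mul1r.
rewrite big_seq_cond big1 => [|j']; first by rewrite /= addr0 => <-.
rewrite mem_index_iota => /andP[j'B j'j].
rewrite mulrC coefM_int; have [ltj'|] := ltnP j' j.
  by rewrite IHj ?mulr0 //; lia.
by move=> lejj'; rewrite TVX coef_qXM ifN ?mul0r //; lia.
Qed.

(** * The generating function of the partitions *)

(** The contribution of j copies of the part p + 1 in a given color: 0 when that
    multiplicity is forbidden. *)
Definition multiplicity_term (n k : nat) (pc : 'I_n * 'I_k) (j : nat) : fps int :=
  if ((3 %| pc.1.+1)%N ==> (j == 0%N)) && (j < 3)%N then q ^+ (pc.1.+1 * j) else 0.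

(** Expanding the product, the choice of a summand in every factor is exactly a
    multiplicity function. *)
Lemma RD_coef k n :
  (RD k 3 3 n)%:Z =
  (\prod_(pc : 'I_n * 'I_k) \sum_(j < n.+1) multiplicity_term pc j) n.
Proof.
rewrite (bigA_distr_bigA (fun pc (j : 'I_n.+1) => multiplicity_term pc j)).
rewrite fps_coef_sum /=.
rewrite /RD -sum1_card -natz natr_sum big_mkcond; apply: eq_bigr => f _ /=.
rewrite inE.
have [allf|/existsP[pc pcf]] := boolP
    [forall pc : 'I_n * 'I_k,
       ((3 %| pc.1.+1)%N ==> (f pc == 0 :> nat)%N) && (f pc < 3)%N].
  rewrite (eq_bigr (fun pc : 'I_n * 'I_k => q ^+ (pc.1.+1 * f pc)))
    => [|pc _]; last first.
    by rewrite /multiplicity_term (forallP allf pc).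
  rewrite prodrXr coef_qX eq_sym.
  have -> : [forall pc : 'I_n * 'I_k,
               (3 %| pc.1.+1)%N ==> (f pc == 0 :> nat)%N].
    by apply/forallP => pc; have /andP[] := forallP allf pc.
  have -> : [forall pc, (f pc < 3)%N].
    by apply/forallP => pc; have /andP[] := forallP allf pc.
  by rewrite !andbT; case: eqP.
rewrite (_ : \prod_pc multiplicity_term pc (f pc) = 0); last first.
  by rewrite (bigD1 pc) //= {1}/multiplicity_term ifN ?mul0r.
case: ifP => // /and3P[_ /forallP f3 /forallP flt].
by move: pcf; rewrite f3 flt.
Qed.

(** The bound j <= n on multiplicities loses nothing modulo q^(n+1), even when
    n = 1 and the summand q^(2(p+1)) is missing. *)
Lemma sum_multiplicity_term n k (pc : 'I_n * 'I_k) :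
  eqmodq n.+1 (\sum_(j < n.+1) multiplicity_term pc j)
    (if (3 %| pc.1.+1)%N then 1 else 1 + q ^+ pc.1.+1 + q ^+ (pc.1.+1 * 2)).
Proof.
have -> : (if (3 %| pc.1.+1)%N then 1
           else 1 + q ^+ pc.1.+1 + q ^+ (pc.1.+1 * 2)) =
    \sum_(j < n.+3) multiplicity_term pc j.
  rewrite !big_ord_recl big1 /multiplicity_term /= => [|j _]; last by rewrite andbF.
  by rewrite muln0 muln1 implybT /=; case: ifP => _ /=; rewrite !addr0 ?addrA.
have small j : (n < j)%N -> eqmodq n.+1 (multiplicity_term pc j) 0.
  move=> ltnj i ltin; rewrite /multiplicity_term; case: ifP => // _.
  by rewrite coef_qX; case: eqP => // iE; lia.
rewrite !(big_ord_recr n.+2) !(big_ord_recr n.+1) /=.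
move=> i ltin; rewrite !fps_coefD !small // ?addr0 //; lia.
Qed.

(** From (1 + q^m + q^(2m)) (1 - q^m) = 1 - q^(3m), the multiples of 3 being
    compensated by the products over 3 | m. *)
Lemma prod_1DqDq2 N :
  \prod_(1 <= m < N.+1) (if (3 %| m)%N then 1 else 1 + q ^+ m + q ^+ (m * 2)) *
  (\prod_(1 <= m < N.+1) (1 - q ^+ m) *
   \prod_(1 <= m < N.+1 | (3 %| m)%N) (1 - q ^+ (m * 3))) =
  \prod_(1 <= m < N.+1) (1 - q ^+ (m * 3)) *
  \prod_(1 <= m < N.+1 | (3 %| m)%N) (1 - q ^+ m).
Proof.
rewrite !prod_mul3_mkcond -!big_split /=; apply: eq_bigr => m _.
by case: ifP => _; rewrite !exprM; ring.
Qed.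

Lemma prod_1DqDq2_trunc N :
  eqmodq N.+1
    (\prod_(1 <= m < N.+1) (if (3 %| m)%N then 1 else 1 + q ^+ m + q ^+ (m * 2)))
    (E 3 ^+ 2 / (E 1 * E 9)).
Proof.
set Q := \prod_(_ <= _ < _) _.
have -> : Q = Q * (E 1 * E 9) / (E 1 * E 9) by rewrite mulrK // unitrM !E_unit.
apply: eqmodqM; last exact: eqmodq_refl.
apply: (@eqmodq_trans _ _ (Q * (poch N *
  \prod_(1 <= m < N.+1 | (3 %| m)%N) (1 - q ^+ (m * 3))))).
  apply: eqmodqM; first exact: eqmodq_refl.
  by apply: eqmodqM; [exact: E1_poch | exact: (@E_mul3_trunc N 3)].
rewrite prod_1DqDq2 expr2; apply: eqmodqM; apply: eqmodq_sym; first exact: E_trunc.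
have := @E_mul3_trunc N 1 isT; rewrite muln1; congr eqmodq.
by apply: eq_bigr => m _; rewrite muln1.
Qed.

Lemma RD_gf k : FPS (fun n => (RD k 3 3 n)%:Z) = (E 3 ^+ 2 / (E 1 * E 9)) ^+ k.
Proof.
apply: fpsP => n; rewrite [LHS]RD_coef.
apply: (_ : eqmodq n.+1 _ _) => //.
apply: (@eqmodq_trans _ _ (\prod_(pc : 'I_n * 'I_k)
  (if (3 %| pc.1.+1)%N then 1 else 1 + q ^+ pc.1.+1 + q ^+ (pc.1.+1 * 2)))).
  by apply: eqmodq_prod => pc _; apply: sum_multiplicity_term.
rewrite -(pair_bigA _ (fun (p : 'I_n) (c : 'I_k) =>
  if (3 %| p.+1)%N then 1 else 1 + q ^+ p.+1 + q ^+ (p.+1 * 2))) /=.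
rewrite (eq_bigr (fun p : 'I_n =>
  (if (3 %| p.+1)%N then 1 else 1 + q ^+ p.+1 + q ^+ (p.+1 * 2)) ^+ k))
  => [|p _]; last first.
  by rewrite prodr_const card_ord.
rewrite prodrXl; apply: eqmodqX; apply: (eqmodq_trans _ (@prod_1DqDq2_trunc n)).
by rewrite big_add1 big_mkord; apply: eqmodq_refl.
Qed.

(** * The induction on k *)

Definition sect (r : nat) (f : fps int) : fps int := FPS (fun n => f (3 * n + r)%N).

Lemma H3_sect r f : (r < 3)%N -> H3 (q ^+ (3 - r) * f) = q ^+ 3 * dil (sect r f).
Proof.
move=> r3; apply: fpsP => n; rewrite H3E part_coef !coef_qXM dil_coef.
case: eqP => n3; last by case: ifP => // n3'; rewrite ifN //; lia.
have [le3n|] := leqP 3 n; last by move=> ltn3; rewrite ifN //; lia.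
rewrite ifT; last by lia.
by rewrite ifT /=; [congr (fcoef f); lia | lia].
Qed.

Definition eta_term (i : nat) : fps int :=
  q ^+ (i - 1) * (E 3 ^+ (3 * (4 * i - 2)) / E 1 ^+ (3 * (4 * i - 2))).

Lemma dil_eta_term i : dil (eta_term i) =
  q ^+ (3 * (i - 1)) * (E 9 ^+ (3 * (4 * i - 2)) / E 3 ^+ (3 * (4 * i - 2))).
Proof.
rewrite !rmorphM /= rmorphV ?unitrX ?E_unit //=.
by rewrite !rmorphXn /= dil_q !dil_E // -exprM.
Qed.

Lemma mul_dil_eta_term_inj i : injective (fun f => dil (eta_term i) * f).
Proof.
move=> f g /=; rewrite dil_eta_term -!mulrA => /qX_inj.
rewrite !(mulrA (_ ^+ _)); apply: mulrI.
by rewrite unitrM unitrV !unitrX // E_unit.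
Qed.

Lemma E9_E1 : E 9 / E 1 = (E 9 / E 3) * (E 3 / E 1).
Proof. by rewrite mulrA divrK ?E_unit. Qed.

Lemma TV_quot j : TV ^+ j = q ^+ (3 * j) * (E 9 / E 3) ^+ (12 * j).
Proof. by rewrite /TV -mulrA -expr_div_n exprMn -!exprM. Qed.

Lemma zetaV_quot j : zetaV ^+ j = q ^+ j * (E 9 / E 1) ^+ (3 * j).
Proof. by rewrite /zetaV -mulrA -expr_div_n exprMn -!exprM. Qed.

Lemma A_gt i j : (1 <= i)%N -> (3 * i <= j)%N -> A i j = 0.
Proof. by move=> i1 leij; rewrite /A; case: M_spec => _ -> //; lia. Qed.

(** The factor dil (eta_term i) is a power of q^3 and E_9/E_3, so it passes
    through H_3, and it completes q^2 eta_term i to zeta^-(4i-2). Expanding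
    H_3(zeta^-(4i-2)) by row 4i - 2 of M and writing T^-(i+j-1) as
    q^3 dil (eta_term i) dil (eta_term j) leaves the entries of row i of A. *)
Lemma H3_eta_term i : (1 <= i)%N ->
  H3 (q ^+ 2 * eta_term i) =
  q ^+ 3 * dil (\sum_(1 <= j < 3 * i) (A i j)%:~R * eta_term j).
Proof.
move=> i1; apply: (@mul_dil_eta_term_inj i); rewrite /= H3E -part_dilM -H3E.
have -> : dil (eta_term i) * (q ^+ 2 * eta_term i) = zetaV ^+ (4 * i - 2).
  rewrite dil_eta_term /eta_term zetaV_quot; set a := (3 * (4 * i - 2))%N.
  have -> : q ^+ (4 * i - 2) = q ^+ (3 * (i - 1)) * q ^+ 2 * q ^+ (i - 1).
    by rewrite -!exprD; congr (_ ^+ _); lia.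
  by rewrite -!expr_div_n E9_E1 (exprMn _ (E 9 / E 3)); ring.
rewrite (proj1 M_spec); last by lia.
(* the entries of M with column index below i vanish *)
rewrite (@big_cat_nat _ _ _ i) /=; try lia.
rewrite big_nat big1 ?add0r => [|j /andP[j1 ji]]; last first.
  by rewrite M_lt ?mul0r //; lia.
have -> (F : nat -> fps int) :
    \sum_(i <= j < (4 * i - 2).+1) F j =
    \sum_(1 <= j < 3 * i) F (j + (i - 1))%N.
  rewrite -{1}(subnKC i1) big_addn.
  by rewrite (_ : (4 * i - 2).+1 - (i - 1) = 3 * i)%N //; lia.
rewrite rmorph_sum /= !mulr_sumr; apply: eq_big_nat => j /andP[j1 ji].
rewrite [dil (_%:~R * _)]rmorphM /= dil_int /A.
rewrite (_ : i + j - 1 = j + (i - 1))%N; last by lia.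
rewrite !dil_eta_term TV_quot -!expr_div_n.
have -> : q ^+ (3 * (j + (i - 1))) =
    q ^+ (3 * (i - 1)) * q ^+ 3 * q ^+ (3 * (j - 1)).
  by rewrite -!exprD; congr (_ ^+ _); lia.
have -> : (E 9 / E 3) ^+ (12 * (j + (i - 1))) =
    (E 9 / E 3) ^+ (3 * (4 * i - 2)) * (E 9 / E 3) ^+ (3 * (4 * j - 2)).
  by rewrite -!exprD; congr (_ ^+ _); lia.
by ring.
Qed.

Definition x_len (k : nat) : nat := ((3 ^ (k - 1) + 1) %/ 2)%N.

Lemma x_lenS k : (1 <= k)%N -> (x_len k.+1).+1 = (3 * x_len k)%N.
Proof.
case: k => // k _; rewrite /x_len !subSS !subn0 expnS.
have : odd (3 ^ k) by rewrite oddX orbT.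
lia.
Qed.

Lemma row_mulE (v : nat -> int) (B : nat -> nat -> int) b j :
  (forall i, (b <= i)%N -> v i = 0) ->
  Defs.row_mul v B j = \sum_(1 <= i < b) v i * B i j.
Proof.
move=> v0; rewrite /Defs.row_mul [RHS]fsbig_seq ?iota_uniq //; symmetry.
apply: fsbig_widen.
  by move=> i /=; rewrite mem_index_iota => /andP[].
move=> i [/= i1]; rewrite mem_index_iota i1 /= => /negP.
by rewrite -leqNgt => /v0 ->; rewrite mul0r.
Qed.

Lemma xS k : (1 <= k)%N -> x k.+1 = Defs.row_mul (x k) A.
Proof. by case: k. Qed.

Lemma x_gt k i : (1 <= k)%N -> (x_len k < i)%N -> x k i = 0.
Proof.
case: k => // k _; elim: k i => [|k IHk] i.
  by rewrite /x_len /= => lti; rewrite /x /= ifN //; lia.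
rewrite x_lenS // xS // => lti; rewrite (row_mulE _ _ IHk).
rewrite big_nat big1 // => i' /andP[i'1 i'k].
by rewrite A_gt ?mulr0 //; lia.
Qed.

Lemma H3_sum_int I (r : seq I) (P : pred I) (c : I -> int) (F : I -> fps int) :
  H3 (\sum_(i <- r | P i) (c i)%:~R * F i) =
  \sum_(i <- r | P i) (c i)%:~R * H3 (F i).
Proof.
rewrite H3E raddf_sum; apply: eq_bigr => i _.
by rewrite mulrzl [RHS]mulrzl; exact: raddfMz.
Qed.

Lemma RD_3n2 :
  FPS (fun n => (RD 3 3 3 (3 * n + 2))%:Z) = 9 * (E 3 ^+ 6 / E 1 ^+ 6).
Proof.
set R := FPS (fun n => (RD 3 3 3 n)%:Z).
apply: dil_inj; apply: (@qX_inj 3) => /=; rewrite -[FPS _]/(sect 2 R) -H3_sect //.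
have dilE : dil (E 3 ^+ 6 / E 1 ^+ 6) = (E 9 / E 3) ^+ 6.
  by rewrite -expr_div_n rmorphXn rmorphM /= rmorphV ?E_unit //= !dil_E.
have Udil : dil (E 3 ^+ 6 / E 1 ^+ 6) \is a GRing.unit.
  by rewrite dilE unitrX // unitrM unitrV !E_unit.
apply: (mulrI Udil); rewrite H3E -part_dilM -H3E dilE.
rewrite (_ : _ * (q ^+ 1 * R) = zetaV).
  rewrite H3_zetaV rmorphM rmorph_nat /= dilE.
  by have := TV_quot 1; rewrite expr1 muln1 => ->; ring.
have := zetaV_quot 1; rewrite expr1 muln1 => ->; rewrite /R RD_gf.
have -> : E 3 ^+ 2 / (E 1 * E 9) = E 3 / E 1 * (E 3 / E 9).
  by rewrite invrM ?E_unit //; ring.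
have a1 : E 9 / E 3 * (E 3 / E 9) = 1.
  by rewrite mulrA divrK ?E_unit // mulrV ?E_unit.
rewrite E9_E1; set a := E 9 / E 3 in a1 *; set b := E 3 / E 1.
set c := E 3 / E 9 in a1 *.
transitivity (q * (a * b) ^+ 3 * (a * c) ^+ 3); first by ring.
by rewrite a1 expr1n mulr1.
Qed.

Unset Implicit Arguments.

Theorem theorem1p1 (k : nat) (hk : (1 <= k)%N) :
  FPS (fun n : nat => (RD 3 3 3 (3 ^ k * n + (3 ^ k + 1) %/ 2))%:Z) =
  \sum_(1 <= i < ((3 ^ (k - 1) + 1) %/ 2).+1)
    (x k i)%:~R * q ^+ (i - 1) *
    (E 3 ^+ (3 * (4 * i - 2)) / E 1 ^+ (3 * (4 * i - 2))).
Proof.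
rewrite -/(x_len k) (eq_bigr (fun i => (x k i)%:~R * eta_term i))
  => [|i _]; last by rewrite -mulrA.
case: k hk => // k _; elim: k => [|k IHk].
  by rewrite big_nat1 /eta_term mul1r -RD_3n2; congr FPS.
set F := FPS _ in IHk.
(* 3^k (3n + 1) + (3^k + 1)/2 = 3^(k+1) n + (3^(k+1) + 1)/2 *)
rewrite (_ : FPS _ = sect 1 F); last first.
  congr FPS; apply/funext => n; rewrite /= expnS.
  have : odd (3 ^ k.+1) by rewrite oddX orbT.
  move=> o; congr (Posz (RD _ _ _ _)); lia.
apply: dil_inj; apply: (@qX_inj 3) => /=; rewrite -H3_sect // IHk mulr_sumr.
rewrite (eq_bigr (fun i => (x k.+1 i)%:~R * (q ^+ 2 * eta_term i)))
  => [|i _]; last by ring.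
rewrite H3_sum_int (@x_lenS k.+1) //.
have -> : \sum_(1 <= i < (x_len k.+1).+1)
      (x k.+1 i)%:~R * H3 (q ^+ 2 * eta_term i) =
    \sum_(1 <= i < (x_len k.+1).+1) q ^+ 3 *
      dil (\sum_(1 <= j < 3 * x_len k.+1) (x k.+1 i * A i j)%:~R * eta_term j).
  apply: eq_big_nat => i /andP[i1 ik].
  rewrite H3_eta_term // mulrCA -dil_int -rmorphM /= mulr_sumr; congr (_ * dil _).
  rewrite [RHS](@big_cat_nat _ _ _ (3 * i)) /=; try lia.
  rewrite [X in _ = _ + X]big_nat [X in _ = _ + X]big1 => [|j /andP[ji _]];
    last first.
    by rewrite A_gt // mulr0 mul0r.
  by rewrite addr0; apply: eq_bigr => j _; rewrite intrM mulrA.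
rewrite -mulr_sumr -rmorph_sum exchange_big /=; congr (_ * dil _).
apply: eq_bigr => j _; rewrite -mulr_suml; congr (_ * _).
rewrite (@xS k.+1) // (row_mulE _ _ (fun i => @x_gt k.+1 i isT)).
by rewrite rmorph_sum.
Qed.
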